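(* Let $\frac mn$ be a positive irreducible fraction. Let $m=m_1+\cdots+m_e$ be any integer partition with $e\ge1$ and $1\le m_1\le\cdots\le m_e\le m$. Then there are infinitely many ways to choose a positive integer $k_e$ and a sequence $n_1,\dots,n_{k_e}$ of positive integers (not necessarily distinct) such that \[ \frac mn=\frac1{n_1}+\cdots+\frac1{n_{k_e}} \] and $S_e=T_e$, where \[ S_e:=\Big\{\sum_{i\in I}\tfrac1{n_i}\in\tfrac1n\mathbb Z : I\subseteq\{1,\dots,k_e\}\Big\},\qquad T_e:=\Big\{\sum_{i\in I}\tfrac{m_i}{n} : I\subseteq\{1,\dots,e\}\Big\}. \]
   Context: $\frac1n\mathbb Z=\{\frac cn: c\in\mathbb Z\}$. $S_e$ is the set of those subset sums of the $\frac1{n_i}$ (over index sets $I$, the empty sum being $0$) that lie in $\frac1n\mathbb Z$. *)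

(* Defs.v *)
From mathcomp Require Import all_boot all_order all_algebra.
From mathcomp Require Import boolp classical_sets cardinality.

Set Implicit Arguments.
Unset Strict Implicit.
Unset Printing Implicit Defensive.

Import Order.TTheory GRing.Theory Num.Theory.

Local Open Scope ring_scope.
Local Open Scope classical_set_scope.

(** Index sets are subsets of the positions of [s], so repeated entries count
    separately and the empty index set contributes [0]. *)
Definition subset_sums (s : seq rat) : set rat :=
  [set q | exists I : {set 'I_(size s)}, q = \sum_(i in I) s`_i].

Definition fracZ (n : nat) : set rat :=
  [set q | exists c : int, q = c%:~R / n%:R].

Definition S_e (n : nat) (ns : seq nat) : set rat :=
  subset_sums [seq (k%:R)^-1 | k <- ns] `&` fracZ n.

Definition T_e (n : nat) (ms : seq nat) : set rat :=
  subset_sums [seq k%:R / n%:R | k <- ms].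

(* Main.v *)
(** Each [m_i/n] is written as [x_1/p_1 + ... + x_r/p_r + 1/N], meaning [x_j]
    copies of [1/p_j] and one [1/N], where [x_j < p_j] and the [p_j] are pairwise
    coprime and coprime to [n] and to every denominator already used. As long as
    the remainder is at least [1] one subtracts [(p - 1)/p]; a remainder
    [u/N < 1] is finished off by a [p] with [u p = 1 + x N], for which
    [u/N - x/p = 1/(N p)]. Coprimality forces a sub-sum in [(1/n)Z] to contain
    all or none of each group. The last [p] can be taken arbitrarily large,
    which gives infinitely many solutions. *)
Require Import Defs.
From mathcomp Require Import all_boot all_order all_algebra.
From mathcomp Require Import boolp classical_sets cardinality.
From mathcomp Require Import ring zify.

Set Implicit Arguments.
Unset Strict Implicit.
Unset Printing Implicit Defensive.

Import Order.TTheory GRing.Theory Num.Theory.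

Local Open Scope ring_scope.
Local Open Scope classical_set_scope.

(** * Subsequences, subset sums and integrality *)

Lemma subseq_catP (T : eqType) (t s1 s2 : seq T) :
  subseq t (s1 ++ s2) ->
  exists t1 t2, [/\ t = t1 ++ t2, subseq t1 s1 & subseq t2 s2].
Proof.
case/subseqP=> b; rewrite size_cat => szb ->.
have sz1 : size (take (size s1) b) = size s1 by rewrite size_takel // szb leq_addr.
exists (mask (take (size s1) b) s1), (mask (drop (size s1) b) s2).
by rewrite -mask_cat // cat_take_drop !mask_subseq.
Qed.

Lemma subseq_nseqP (T : eqType) (t : seq T) (x : nat) (a : T) :
  subseq t (nseq x a) -> exists2 y, (y <= x)%N & t = nseq y a.
Proof.
move=> sub; exists (size t); first by rewrite -(size_nseq x a) size_subseq.
by apply/all_pred1P/allP=> z /(mem_subseq sub); rewrite mem_nseq => /andP[].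
Qed.

(** Trades index sets for subsequences, which split along concatenations; a boolean mask translates
    between the two. *)
Lemma subset_sums_mapP (f : nat -> rat) (s : seq nat) (q : rat) :
  subset_sums (map f s) q <->
  exists2 t, subseq t s & q = \sum_(k <- t) f k.
Proof.
split=> [[I ->]|[t /subseqP[b szb ->] ->]].
  pose b := [seq i \in I | i <- enum 'I_(size (map f s))].
  exists (mask b s); first exact: mask_subseq.
  rewrite -(big_map f predT id) map_mask big_mask; apply: eq_big => [i|i _].
    by rewrite andbT (nth_map i) ?size_enum_ord // nth_ord_enum.
  by rewrite (tnth_nth 0).
exists (finset (fun i : 'I_(size (map f s)) => nth false b i)).
rewrite -(big_map f predT id) map_mask big_mask.
apply: eq_big => [i|i _]; first by rewrite finset.in_set andbT.
by rewrite (tnth_nth 0).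
Qed.

Lemma fracZE (n : nat) (q : rat) :
  (0 < n)%N -> fracZ n q <-> n%:R * q \is a Num.int.
Proof.
move=> n_gt0; have n0 : n%:R != 0 :> rat by rewrite pnatr_eq0 -lt0n.
split=> [[c ->]|/intrP[c nq]]; first by rewrite mulrC divfK // intr_int.
by exists c; rewrite -nq mulrC mulKf.
Qed.

Lemma int_div_dvdn (a p : nat) :
  (0 < p)%N -> a%:R / p%:R \is a @Num.int rat -> (p %| a)%N.
Proof.
move=> p_gt0 /intrP[c ac].
have p0 : p%:R != 0 :> rat by rewrite pnatr_eq0 -lt0n.
have : (a%:Z)%:~R = (c * p%:Z)%:~R :> rat by rewrite intrM -ac divfK.
by move=> /intr_inj E; rewrite -[a]/(absz a%:Z) E abszM dvdn_mull.
Qed.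

Lemma dvdn_mul_frac_int (u N D : nat) :
  (N %| D)%N -> D%:R * (u%:R / N%:R) \is a @Num.int rat.
Proof.
case/dvdnP=> d ->; case: N => [|N]; first by rewrite muln0 mul0r.
by rewrite mulrCA natrM mulfK ?pnatr_eq0 // -natrM natr_int.
Qed.

(** * Groups of unit fractions that are taken all or none *)

Definition unit_sum (ns : seq nat) : rat := \sum_(k <- ns) (k%:R)^-1.

Lemma unit_sum_cat s t : unit_sum (s ++ t) = unit_sum s + unit_sum t.
Proof. exact: big_cat. Qed.

Lemma unit_sum_nseq x p : unit_sum (nseq x p) = x%:R / p%:R.
Proof. by rewrite /unit_sum big_nseq iter_addr_0 mulr_natl. Qed.

(* [D] is a multiple of all denominators used by the other groups. *)
Definition isolates (D B : nat) (r : rat) : Prop :=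
  exists ns, [/\ all (leq 1) ns, has (ltn B) ns, unit_sum ns = r &
    forall t, subseq t ns -> D%:R * unit_sum t \is a Num.int ->
      unit_sum t = 0 \/ unit_sum t = r].

Lemma isolates_unit (D B N : nat) : (B < N)%N -> isolates D B (N%:R)^-1.
Proof.
move=> BN; exists [:: N]; split; first by rewrite /= andbT; lia.
- by rewrite /= BN.
- by rewrite /unit_sum big_seq1.
move=> t /(@subseq_nseqP _ _ 1)[[|[|//]] _ ->] _.
  by left; rewrite /unit_sum big_nil.
by right; rewrite /unit_sum big_seq1.
Qed.

Lemma coprime_frac_small (D p y : nat) :
  coprime p D -> (y < p)%N -> D%:R * (y%:R / p%:R) \is a @Num.int rat -> y = 0%N.
Proof.
move=> cop yp; rewrite mulrA -natrM => /int_div_dvdn.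
rewrite Gauss_dvdr // => dvd; apply/eqP; rewrite -leqn0 leqNgt; apply/negP=> y0.
by have := dvdn_leq y0 (dvd (leq_ltn_trans (leq0n y) yp)); rewrite leqNgt yp.
Qed.

(* A sub-sum with [y <= x] copies of [1/p] leaves a [1/(D p)]-integral sub-sum
   of the rest, hence [0] or everything; then [y/p], resp. [(x - y)/p], is in
   [(1/D)Z], which forces [y = 0], resp. [y = x]. *)
Lemma isolates_step (D B p x : nat) (r : rat) :
  coprime p D -> (x < p)%N -> D%:R * r \is a Num.int ->
  isolates (D * p) B (r - x%:R / p%:R) ->
  isolates D B r.
Proof.
move=> cop xp intDr [ns [pos big sumns iso]].
have p0 : p%:R != 0 :> rat by rewrite pnatr_eq0; lia.
exists (nseq x p ++ ns); split.
- by rewrite all_cat pos andbT; apply/allP=> z /nseqP[-> _]; lia.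
- by rewrite has_cat big orbT.
- by rewrite unit_sum_cat sumns unit_sum_nseq addrC subrK.
move=> t /subseq_catP[_ [t2 [-> /subseq_nseqP[y yx ->] sub2]]].
rewrite unit_sum_cat unit_sum_nseq => intD.
have : (D * p)%:R * unit_sum t2 \is a Num.int.
  have -> : (D * p)%:R * unit_sum t2 =
      p%:R * (D%:R * (y%:R / p%:R + unit_sum t2)) - (D * y)%:R.
    by rewrite !natrM; field.
  by apply: rpredB; [apply: rpredM => // |]; exact: natr_int.
case/(iso _ sub2) => E; rewrite E in intD *.
  rewrite addr0 in intD *; left.
  by rewrite (coprime_frac_small cop _ intD) ?mul0r //; lia.
right; suff xy : (x - y)%N = 0%N.
  by rewrite (_ : y = x); [rewrite addrC subrK | lia].
apply: (coprime_frac_small cop); first by lia.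
have -> : D%:R * ((x - y)%:R / p%:R) =
    D%:R * r - D%:R * (y%:R / p%:R + (r - x%:R / p%:R)).
  by rewrite natrB //; field.
exact: rpredB.
Qed.

(** Chinese remaindering: [p = a] modulo [N] makes [p] coprime to the part of [D] built from primes
    of [N], and [p = 1] modulo the complementary part [D'] handles the other primes. *)
Lemma coprime_lift (a N D B : nat) :
  (0 < N)%N -> (0 < D)%N -> (N %| D)%N -> coprime a N ->
  exists p, [/\ coprime p D, (B < p)%N & p = a %[mod N]].
Proof.
move=> N_gt0 D_gt0 ND aN.
pose D' := (D`_(\pi(N)^'))%N.
have ND' : coprime N D' by apply: pnat_coprime (pnat_pi N_gt0) (part_pnat _ _).
pose c := chinese N D' a 1.
(* Adding a multiple of [D] keeps both residues and pushes [p] beyond [B]. *)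
pose p := (B.+1 * D + c)%N.
have pN : p = a %[mod N] by rewrite /p -(divnK ND) mulnA modnMDl chinese_modl.
have pD' : p = 1 %[mod D'].
  by rewrite /p -(divnK (dvdn_part _ _ : (D' %| D)%N)) mulnA modnMDl chinese_modr.
have p_gt0 : (0 < p)%N by nia.
exists p; split=> //; last by nia.
rewrite -(partnC \pi(N) D_gt0) coprimeMr; apply/andP; split; last first.
  by rewrite -coprime_modl pD' coprime_modl coprime1n.
rewrite coprime_sym; apply: pnat_coprime (part_pnat _ _) _.
by rewrite -coprime_pi' // coprime_sym -coprime_modl pN coprime_modl.
Qed.

Lemma isolates_lt1 (u N D B : nat) :
  (0 < u)%N -> (u < N)%N -> (0 < D)%N -> (N %| D)%N -> coprime u N ->
  isolates D B (u%:R / N%:R).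
Proof.
move=> u_gt0 uN D_gt0 ND cop; have N_gt0 : (0 < N)%N by lia.
(* Bézout gives [a * u = b * N + 1], so [a], and later [p], is an inverse of [u] modulo [N]. *)
case: (egcdnP N u_gt0) => a b; rewrite (eqP cop) => aub _.
have aN : coprime a N.
  have : coprime (a * u) N by rewrite aub coprime_sym /coprime gcdnMDl gcdn1.
  by rewrite coprimeMl => /andP[].
have [p [pD Bp pa]] := coprime_lift B N_gt0 D_gt0 ND aN.
have up1 : u * p = 1 %[mod N] by rewrite -modnMmr pa modnMmr mulnC aub modnMDl.
have up_gt0 : (0 < u * p)%N by rewrite muln_gt0 u_gt0; lia.
have /dvdnP[x upx] : (N %| u * p - 1)%N by rewrite -eqn_mod_dvd // up1.
have NR : N%:R != 0 :> rat by rewrite pnatr_eq0 -lt0n.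
have pR : p%:R != 0 :> rat by rewrite pnatr_eq0; lia.
(* Here [x < p] because [x * N = u * p - 1] and [u < N]. *)
apply: (isolates_step (x := x) pD); first by nia.
  exact: dvdn_mul_frac_int.
have -> : u%:R / N%:R - x%:R / p%:R = (N * p)%:R^-1 :> rat.
  have E : u%:R * p%:R = x%:R * N%:R + 1 :> rat by rewrite -!natrM natr1; congr _%:R; lia.
  have -> : x%:R = (u%:R * p%:R - 1) / N%:R :> rat by rewrite E addrK mulfK.
  by rewrite natrM; field; rewrite NR pR.
by apply: isolates_unit; nia.
Qed.

(** Induction on the bound [k] for [u / N]. Subtracting [D / (D + 1)], although less than 1, brings
    the value below the next bound: [u / N] is at least [1 / N] below the old one, and
    [1 / (D + 1) < 1 / N] since [N <= D]. *)
Lemma isolates_frac (k u N D B : nat) :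
  (0 < u)%N -> (0 < N)%N -> (u < k * N)%N -> (0 < D)%N -> (N %| D)%N ->
  coprime u N -> isolates D B (u%:R / N%:R).
Proof.
elim: k u N D => [|k IH] u N D u_gt0 N_gt0 uk D_gt0 ND cop; first by lia.
have [uN|Nu] := ltnP u N; first exact: isolates_lt1.
have leND := dvdn_leq D_gt0 ND.
have NR : N%:R != 0 :> rat by rewrite pnatr_eq0 -lt0n.
have DR : D.+1%:R != 0 :> rat by rewrite pnatr_eq0.
apply: (isolates_step (p := D.+1) (x := D)) => //; first exact: coprimeSn.
  exact: dvdn_mul_frac_int.
have -> : u%:R / N%:R - D%:R / D.+1%:R
    = (u * D.+1 - D * N)%:R / (N * D.+1)%:R :> rat.
  by rewrite natrB; [rewrite !natrM; field; rewrite NR addrC natr1 DR | nia].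
have le : (D * N <= u * D.+1)%N by nia.
apply: IH; [nia | nia | nia | nia | exact: dvdn_mul |].
(* The new fraction is again reduced: [e] is [u * (D + 1)] modulo [N], and [N] modulo [D + 1]. *)
set e := (_ - _)%N; have uE : (u * D.+1 = D * N + e)%N by rewrite /e; lia.
have PN : coprime D.+1 N by apply: coprime_dvdr ND (coprimeSn D).
rewrite coprime_sym coprimeMl /coprime; apply/andP; split.
  by rewrite -(gcdnMDl D) -uE -/(coprime _ _) coprimeMr !(coprime_sym N) cop.
have -> : gcdn D.+1 e = gcdn D.+1 (u * D.+1 + N).
  by rewrite -(gcdnMDl N); congr gcdn; lia.
by rewrite gcdnMDl.
Qed.

Lemma isolates_pos_frac (a n D B : nat) :
  (0 < a)%N -> (0 < n)%N -> (0 < D)%N -> (n %| D)%N ->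
  isolates D B (a%:R / n%:R).
Proof.
move=> a_gt0 n_gt0 D_gt0 nD.
have g_gt0 : (0 < gcdn a n)%N by rewrite gcdn_gt0 a_gt0.
have gR : (gcdn a n)%:R != 0 :> rat by rewrite pnatr_eq0 -lt0n.
have [Ea En] : a = (a %/ gcdn a n * gcdn a n)%N /\ n = (n %/ gcdn a n * gcdn a n)%N.
  by rewrite !divnK ?dvdn_gcdl ?dvdn_gcdr.
have a'_gt0 : (0 < a %/ gcdn a n)%N by nia.
have n'_gt0 : (0 < n %/ gcdn a n)%N by nia.
have -> : a%:R / n%:R = (a %/ gcdn a n)%:R / (n %/ gcdn a n)%:R :> rat.
  by rewrite [X in X%:R / _ = _]Ea [X in _ / X%:R = _]En !natrM -mulf_div divff // mulr1.
apply: (isolates_frac (k := (a %/ gcdn a n).+1)) => //; first by nia.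
  by apply: dvdn_trans nD; rewrite [X in (_ %| X)%N]En dvdn_mulr.
by rewrite /coprime -(eqn_pmul2r g_gt0) mul1n muln_gcdl -Ea -En.
Qed.

(** * Assembling the groups of a partition *)

Lemma unit_sum_int (D : nat) (t : seq nat) :
  {in t, forall k, k %| D}%N -> D%:R * unit_sum t \is a Num.int.
Proof.
move=> tD; rewrite /unit_sum mulr_sumr big_seq rpred_sum // => k /tD kD.
by rewrite -[_^-1]mul1r (dvdn_mul_frac_int 1).
Qed.

Lemma partition_realization (n B : nat) (ms : seq nat) :
  (0 < n)%N -> all (leq 1) ms ->
  exists ns,
    [/\ all (leq 1) ns,
        (0 < size ms)%N -> has (ltn B) ns,
        unit_sum ns = \sum_(k <- ms) k%:R / n%:R,
        forall t, subseq t ns -> n%:R * unit_sum t \is a Num.int ->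
          exists2 s, subseq s ms & unit_sum t = \sum_(k <- s) k%:R / n%:R
      & forall s, subseq s ms ->
          exists2 t, subseq t ns & unit_sum t = \sum_(k <- s) k%:R / n%:R].
Proof.
move=> n_gt0; elim: ms => [|a ms IH] /=.
  move=> _; exists [::]; split=> //; first by rewrite /unit_sum !big_nil.
    by move=> t /eqP-> _; exists [::]; rewrite // /unit_sum !big_nil.
  by move=> s /eqP->; exists [::]; rewrite // /unit_sum !big_nil.
case/andP=> a_gt0 /IH[ns [pos _ sumns SsubT TsubS]].
have posP k : k \in ns -> (0 < k)%N by move/allP: pos; apply.
(* Every sub-sum of the old groups becomes integral when multiplied by [D], so the integrality of a
   mixed sum passes to its part in the new group. *)
pose D := (n * \prod_(k <- ns) k)%N.
have prod_gt0 : (0 < \prod_(k <- ns) k)%N.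
  by rewrite big_seq prodn_cond_gt0 // => k /posP.
have D_gt0 : (0 < D)%N by rewrite muln_gt0 n_gt0.
have nD : (n %| D)%N by rewrite dvdn_mulr.
have [ns' [pos' big' sumns' iso]] := isolates_pos_frac B a_gt0 n_gt0 D_gt0 nD.
exists (ns' ++ ns); split.
- by rewrite all_cat pos pos'.
- by rewrite has_cat big'.
- by rewrite unit_sum_cat big_cons sumns sumns'.
- move=> _ /subseq_catP[t' [t [-> sub' sub]]]; rewrite unit_sum_cat => intn.
  have intt : D%:R * unit_sum t \is a Num.int.
    apply: unit_sum_int => k /(mem_subseq sub) kns.
    by rewrite dvdn_mull // (perm_big _ (perm_to_rem kns)) big_cons dvdn_mulr.
  have intt' : D%:R * unit_sum t' \is a Num.int.
    have -> : D%:R * unit_sum t' = (\prod_(k <- ns) k)%:R *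
        (n%:R * (unit_sum t' + unit_sum t)) - D%:R * unit_sum t.
      by rewrite /D natrM; ring.
    by apply: rpredB => //; apply: rpredM => //; exact: natr_int.
  have [E|E] := iso _ sub' intt'.
    rewrite E add0r in intn *; have [s subs ->] := SsubT _ sub intn.
    by exists s => //; exact: subseq_trans subs (subseq_cons _ _).
  (* The full new group contributes [a / n], so removing it lowers [n] times the sum by the integer
     [a]. *)
  have [|s subs Es] := SsubT _ sub.
    have -> : n%:R * unit_sum t = n%:R * (unit_sum t' + unit_sum t) - a%:R.
      by rewrite E; field; rewrite pnatr_eq0 -lt0n.
    by apply: rpredB => //; exact: natr_int.
  by exists (a :: s); rewrite /= ?eqxx // E Es big_cons.
- case=> [|b s]; first by exists [::]; [exact: sub0seq | rewrite /unit_sum !big_nil].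
  (* A head equal to [a] is realized by the whole new group; otherwise the old groups suffice. *)
  rewrite /=; case: eqVneq => [->|_] /TsubS[t sub Et].
    exists (ns' ++ t); first exact: cat_subseq.
    by rewrite unit_sum_cat big_cons Et sumns'.
  exists t => //; exact: subseq_trans sub (suffix_subseq _ _).
Qed.

Theorem theorem1p3 (m n : nat) (m_gt0 : (0 < m)%N) (n_gt0 : (0 < n)%N)
    (mn_coprime : coprime m n)
    (ms : seq nat) (ms_nonempty : (0 < size ms)%N)
    (ms_sorted : sorted leq ms)
    (ms_bounds : forall x : nat, x \in ms -> (1 <= x <= m)%N)
    (ms_sum : (\sum_(x <- ms) x)%N = m) :
  infinite_set [set ns : seq nat |
    [/\ (0 < size ns)%N,
        forall k : nat, k \in ns -> (0 < k)%N,
        m%:R / n%:R = \sum_(k <- ns) (k%:R : rat)^-1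
      & S_e n ns = T_e n ms]].
Proof.
case/finite_seqP=> l El.
(* If the solutions formed a finite list [l], [B] would bound every entry of each of them; a
   solution with an entry above [B] is then a contradiction. *)
pose B := (\sum_(ns <- l) \sum_(k <- ns) k)%N.
have ms_pos : all (leq 1) ms by apply/allP=> x /ms_bounds/andP[].
have sumT s : \sum_(k <- s) k%:R / n%:R = (\sum_(k <- s) k)%N%:R / n%:R :> rat.
  by rewrite -mulr_suml natr_sum.
have [ns [pos /(_ ms_nonempty)/hasP[K Kns BK] sumns SsubT TsubS]] :=
  partition_realization B n_gt0 ms_pos.
suff nsl : ns \in l.
  have : (K <= B)%N.
    rewrite /B (perm_big _ (perm_to_rem nsl)) big_cons.
    apply: leq_trans (leq_addr _ _).
    by rewrite (perm_big _ (perm_to_rem Kns)) big_cons leq_addr.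
  by rewrite leqNgt => /negP; apply.
suff : [set` l] ns by [].
rewrite -El /=; split.
- by case: (ns) Kns.
- by move=> k kns; move/allP: pos; apply.
- by rewrite -/(unit_sum ns) sumns sumT ms_sum.
apply/seteqP; split=> q /=.
  case=> /subset_sums_mapP[t sub ->] /(fracZE _ n_gt0) intt.
  have [s subs Es] := SsubT _ sub intt.
  by apply/subset_sums_mapP; exists s.
case/subset_sums_mapP=> s subs ->; split.
  by have [t sub Et] := TsubS _ subs; apply/subset_sums_mapP; exists t.
apply/(fracZE _ n_gt0); rewrite sumT mulrC divfK ?natr_int //.
by rewrite pnatr_eq0 -lt0n.
Qed.
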